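(* For every integer $m\ge 1$, the subdigraph of $\mathcal D^*_m$ induced by the set of vertices (binary words) having an odd number of $0$'s is a bipartite digraph.
   Context: A digraph is bipartite if its vertex set can be partitioned into two classes so that no arc joins two vertices of the same class. Digraph $\mathcal D_m$: let $\mathcal D_{ud}$ be the digraph on $\{a,b,c,d,e,f\}$ with arcs from each of $a,b,d$ to each of $b,c,f$, and from each of $c,e,f$ to each of $a,d,e$; let $\mathcal D_{lr}$ be the digraph on the same letters with arcs from each of $a,c,e$ to each of $d,e,f$, and from each of $b,d,f$ to each of $a,b,c$. $V(\mathcal D_m)$ is the set of words $\alpha_1\cdots\alpha_m$ over $\{a,b,c,d,e,f\}$ with $\alpha_1\in\{a,d,e\}$, $\alpha_m\in\{c,e,f\}$ and each $(\alpha_i,\alpha_{i+1})$, $1\le i\le m-1$, an arc of $\mathcal D_{ud}$. There is an arc $\alpha_1\cdots\alpha_m\to\beta_1\cdots\beta_m$ in $\mathcal D_m$ iff every $(\alpha_i,\beta_i)$ is an arc of $\mathcal D_{lr}$. Digraph $\mathcal D^*_m$: the outlet word of $\alpha=\alpha_1\cdots\alpha_m\in V(\mathcal D_m)$ is the binary word $o(\alpha)=o_1\cdots o_m$ with $o_j=0$ if $\alpha_j\in\{b,d,f\}$ and $o_j=1$ if $\alpha_j\in\{a,c,e\}$. Then $V(\mathcal D^*_m)=\{o(\alpha):\alpha\in V(\mathcal D_m)\}$, and there is a (single) arc $v\to w$ in $\mathcal D^*_m$ iff there are $x,y\in V(\mathcal D_m)$ with $x\to y$ in $\mathcal D_m$,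 $o(x)=v$, $o(y)=w$ (loops allowed). *)

(* Defs.v *)
From HB Require Import structures.
From mathcomp Require Import all_boot.

Set Implicit Arguments.
Unset Strict Implicit.
Unset Printing Implicit Defensive.

(* A digraph whose vertices form a set of elements of T. Loops are allowed and
   there are no parallel arcs. *)
Record digraph (T : finType) := Digraph {
  vertices : {set T};
  arc : rel T;
  arc_vertices : forall x y, arc x y -> (x \in vertices) && (y \in vertices)
}.

Section Induced.
Variables (T : finType) (D : digraph T) (S : {set T}).

Definition induced_arc : rel T :=
  fun x y => [&& x \in S, y \in S & arc D x y].

Lemma induced_arc_vertices x y :
  induced_arc x y -> (x \in vertices D :&: S) && (y \in vertices D :&: S).
Proof.
by case/and3P=> xS yS /arc_vertices/andP[xD yD]; rewrite !inE xS yS xD yD.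
Qed.

Definition induced_subdigraph : digraph T := Digraph induced_arc_vertices.

End Induced.

(* The classes A and B may be empty. *)
Definition bipartite_digraph (T : finType) (D : digraph T) : Prop :=
  exists A B : {set T},
    [/\ A :|: B = vertices D, [disjoint A & B] &
        forall x y, arc D x y ->
          ~ (x \in A /\ y \in A) /\ ~ (x \in B /\ y \in B)].

Inductive letter := La | Lb | Lc | Ld | Le | Lf.

Definition letter_code (x : letter) : nat :=
  match x with La => 0 | Lb => 1 | Lc => 2 | Ld => 3 | Le => 4 | Lf => 5 end.

Definition letter_decode (n : nat) : option letter :=
  nth None [seq Some x | x <- [:: La; Lb; Lc; Ld; Le; Lf]] n.

Lemma letter_codeK : pcancel letter_code letter_decode.
Proof. by case. Qed.

HB.instance Definition _ := Countable.copy letter (pcan_type letter_codeK).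

Lemma letter_enumP : Finite.axiom [:: La; Lb; Lc; Ld; Le; Lf].
Proof. by case. Qed.

HB.instance Definition _ := isFinite.Build letter letter_enumP.

Definition ud_arc : rel letter := fun x y =>
  (x \in [:: La; Lb; Ld]) && (y \in [:: Lb; Lc; Lf]) ||
  (x \in [:: Lc; Le; Lf]) && (y \in [:: La; Ld; Le]).

Definition lr_arc : rel letter := fun x y =>
  (x \in [:: La; Lc; Le]) && (y \in [:: Ld; Le; Lf]) ||
  (x \in [:: Lb; Ld; Lf]) && (y \in [:: La; Lb; Lc]).

Section TransferDigraphs.
Variable m : nat.

(* The default letters Lb of head and La of last are only used when m = 0;
   neither is an admissible end letter, so the empty word is excluded. *)
Definition Dm_vertices : {set m.-tuple letter} :=
  [set w : m.-tuple letter |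
    [&& head Lb w \in [:: La; Ld; Le],
        last La w \in [:: Lc; Le; Lf] &
        sorted ud_arc w]].

Definition Dm_arc : rel (m.-tuple letter) := fun x y =>
  [&& x \in Dm_vertices, y \in Dm_vertices &
      [forall i : 'I_m, lr_arc (tnth x i) (tnth y i)]].

Lemma Dm_arc_vertices x y :
  Dm_arc x y -> (x \in Dm_vertices) && (y \in Dm_vertices).
Proof. by case/and3P=> -> ->. Qed.

Definition Dm : digraph (m.-tuple letter) := Digraph Dm_arc_vertices.

(* In binary words, the digit 0 is false and the digit 1 is true. *)
Definition outlet_digit (x : letter) : bool := x \in [:: La; Lc; Le].

Definition outlet_word (w : m.-tuple letter) : m.-tuple bool :=
  map_tuple outlet_digit w.

Definition Dstar_vertices : {set m.-tuple bool} :=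
  [set outlet_word w | w in vertices Dm].

Definition Dstar_arc : rel (m.-tuple bool) := fun v w =>
  [exists x, exists y,
    [&& arc Dm x y, outlet_word x == v & outlet_word y == w]].

Lemma Dstar_arc_vertices v w :
  Dstar_arc v w -> (v \in Dstar_vertices) && (w \in Dstar_vertices).
Proof.
case/existsP=> x /existsP[y /and3P[/arc_vertices/andP[xD yD] /eqP<- /eqP<-]].
by rewrite !imset_f.
Qed.

Definition Dstar : digraph (m.-tuple bool) := Digraph Dstar_arc_vertices.

Definition odd_zeros : {set m.-tuple bool} :=
  [set w : m.-tuple bool | odd (count_mem false w)].

End TransferDigraphs.

(* Main.v *)
Require Import Defs.
From mathcomp Require Import all_boot.
From mathcomp Require Import ssralg ssrnum ssrint zify.

(** Each letter is a cell of a grid joined to exactly two of its four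
    neighbours: [ud_arc] says that the lower edge of a cell is the upper edge of
    the next one, [lr_arc] that the right edge of a cell is the left edge of its
    neighbour, and the outlet digit records whether there is a right edge.

    Let [x -> y] be an arc of [Dm]. The outlet digit of [x_i] tells whether
    [y_i] has a left edge, so, [y_i] having degree two, the zeros of the two
    outlet words at position [i] number exactly the vertical edges at [y_i]
    ([zeros_eq_vertical_edges]). Summed with alternating signs down the column,
    the vertical edges cancel in pairs, as none leaves the column at either end
    ([alt_zeros_column]). Hence the alternating count of zeros is negated along
    every arc of [Dstar]. It has the parity of the number of zeros, so it never
    vanishes on words with an odd number of zeros, and its sign is a proper
    2-colouring of these. *)

Definition up_edge (x : letter) : bool := x \in [:: Lb; Lc; Lf].
Definition down_edge (x : letter) : bool := x \in [:: La; Lb; Ld].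

(** The right-hand side is also 2 minus the number of horizontal edges at [y]. *)
Lemma zeros_eq_vertical_edges x y : lr_arc x y ->
  ~~ outlet_digit x + ~~ outlet_digit y = up_edge y + down_edge y.
Proof. by case: x; case: y. Qed.

Lemma ud_arc_edge x y : ud_arc x y -> down_edge x = up_edge y.
Proof. by case: x; case: y. Qed.

Fixpoint alt_zeros (s : seq bool) : int :=
  if s is b :: s' then ((~~ b)%:Z - alt_zeros s')%R else 0%R.

Lemma odd_alt_zeros s : odd `|alt_zeros s| = odd (count_mem false s).
Proof.
elim: s => [|b s IHs] //=; rewrite oddD -IHs.
by case: b => /=; lia.
Qed.

(** A telescoping sum: the lower edge of each cell is the upper edge of the
    next, where it occurs with the opposite sign, so only the upper edge of the
    first cell survives when the last cell has no lower edge. *)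
Lemma alt_zeros_column y (xs ys : seq letter) :
  all2 lr_arc xs (y :: ys) -> path ud_arc y ys -> ~~ down_edge (last y ys) ->
  (alt_zeros (map outlet_digit xs) +
     alt_zeros (map outlet_digit (y :: ys)))%R = up_edge y.
Proof.
elim: ys y xs => [|y' ys IHys] y [|x xs] //= /andP[/zeros_eq_vertical_edges Exy].
  by case: xs => //= _ _ /negbTE lastN; rewrite lastN in Exy; lia.
move=> lr_xs /andP[/ud_arc_edge Eyy' ud_ys] lastN.
by have /= := IHys y' xs lr_xs ud_ys lastN; rewrite Eyy' in Exy; lia.
Qed.

Lemma Dm_arc_alt_zeros m (x y : m.-tuple letter) : Dm_arc x y ->
  (alt_zeros (outlet_word x) + alt_zeros (outlet_word y))%R = 0%R.
Proof.
case/and3P=> _; rewrite inE => /and3P[headP lastP sortP] /forallP lr_xy.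
have: all2 lr_arc x y.
  rewrite all2E !size_tuple eqxx /=; apply/(all_nthP (La, La)) => i.
  rewrite size_zip !size_tuple minnn => lt_im.
  have := lr_xy (Ordinal lt_im).
  by rewrite nth_zip ?size_tuple //= !(tnth_nth La).
rewrite /=; case: (tval y) headP lastP sortP => [|z ys] //= headP lastP sortP.
move=> lr_xs; have -> // := alt_zeros_column _ _ _ lr_xs sortP.
- by case: z headP {lastP sortP lr_xs}.
- by case: (last z ys) lastP.
Qed.

Lemma Dstar_arc_alt_zeros m (v w : m.-tuple bool) : Dstar_arc v w ->
  (alt_zeros v + alt_zeros w)%R = 0%R.
Proof.
case/existsP=> x /existsP[y /and3P[xy /eqP<- /eqP<-]].
exact: Dm_arc_alt_zeros.
Qed.

Theorem theorem3p14 (m : nat) (hm : 1 <= m) :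
  bipartite_digraph (induced_subdigraph (Dstar m) (odd_zeros m)).
Proof.
pose D := induced_subdigraph (Dstar m) (odd_zeros m).
pose P := [set w : m.-tuple bool | (0 < alt_zeros w)%R].
exists (vertices D :&: P), (vertices D :\: P); split.
- exact: setID.
- by rewrite -setI_eq0 setDE setIACA setICr setI0.
move=> v w /and3P[]; rewrite !inE -!odd_alt_zeros => odd_v odd_w.
move=> /Dstar_arc_alt_zeros sum0.
split=> -[].
  by move=> /andP[_ v_gt0] /andP[_ w_gt0]; lia.
by move=> /andP[v_le0 _] /andP[w_le0 _]; lia.
Qed.
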